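(* Let $\tilde{T}$ be the map on $\mathbb{R}^+$ given by $\tilde{T}(x) = x - \frac{1}{x}$ if $x \ge 1$ and $\tilde{T}(x) = \frac{1}{x} - x$ if $0 < x \le 1$, and let $\tilde{P}$ be its Perron-Frobenius operator. If $$\mathcal{F} := \left\{ \tilde{g} \in L^1(\mathbb{R}^+, m) \,:\, \tilde{g} \in C^2,\ \tilde{g} > 0,\ \tilde{g}' < 0,\ \tilde{g}'' + \tilde{g}' < 0 \right\},$$ where the inequalities are pointwise on $\mathbb{R}^+$, then $\tilde{P}(\mathcal{F}) \subset \mathcal{F}$.
   Context: $\mathbb{R}^+ = (0, +\infty)$ and $m$ is the Lebesgue measure on $\mathbb{R}^+$. The map $\tilde{T}$ has two inverse branches $\phi_0 : [0,+\infty) \to [1,+\infty)$ and $\phi_1 : [0,+\infty) \to (0,1]$, given by $\phi_0(x) = \frac{x}{2} + \sqrt{\frac{x^2}{4} + 1}$ and $\phi_1(x) = -\frac{x}{2} + \sqrt{\frac{x^2}{4} + 1}$. The Perron-Frobenius operator of $\tilde{T}$ (transfer operator with respect to $m$) acts on $\tilde{g} \in L^1(\mathbb{R}^+, m)$ by $$(\tilde{P} \tilde{g})(x) = |\phi_0'(x)|\, \tilde{g}(\phi_0(x)) + |\phi_1'(x)|\, \tilde{g}(\phi_1(x)), \qquad x > 0.$$ *)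

(* Defs.v *)
(* MathComp-Analysis *)
From HB Require Import structures.
From mathcomp Require Import all_boot all_order all_algebra.
From mathcomp Require Import all_classical all_reals all_analysis.
From mathcomp Require Import ring lra.

Set Implicit Arguments.
Unset Strict Implicit.
Unset Printing Implicit Defensive.

Import Order.TTheory GRing.Theory Num.Theory.
Import numFieldNormedType.Exports.

Local Open Scope ring_scope.
Local Open Scope classical_set_scope.

(* Functions on R^+ are represented by total functions R -> R; their values
   outside `]0, +oo[ are never used. *)
Definition Rplus (R : realType) : set R := `]0, +oo[.
Arguments Rplus : clear implicits.

(* The two formulas agree at x = 1; values at x <= 0 are junk. *)
Definition Ttilde (R : realType) (x : R) : R :=
  if 1 <= x then x - x^-1 else x^-1 - x.

Definition phi0 (R : realType) (x : R) : R :=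
  x / 2 + Num.sqrt (x ^+ 2 / 4 + 1).

Definition phi1 (R : realType) (x : R) : R :=
  - (x / 2) + Num.sqrt (x ^+ 2 / 4 + 1).

(* The transfer operator of [Ttilde] with respect to Lebesgue measure: a sum
   over the two inverse branches of [Ttilde] (see [Ttilde_preimage]). *)
Definition Ptilde (R : realType) (g : R -> R) (x : R) : R :=
  `|(@phi0 R)^`() x| * g (phi0 x) + `|(@phi1 R)^`() x| * g (phi1 x).

(* C^2 on an open set D.  The derivability conditions are needed because
   [derive1] is total. *)
Definition C2_on (R : realType) (D : set R) (g : R -> R) : Prop :=
  forall x, D x ->
    [/\ derivable g x 1, derivable g^`() x 1 & {for x, continuous g^`(2)}].

(* An L^1-class is given here by its C^2 representative on R^+, which is
   unique since continuous functions equal a.e. on R^+ coincide. *)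
Definition calF (R : realType) : set (R -> R) :=
  [set g : R -> R | [/\ (@lebesgue_measure R).-integrable (Rplus R) (EFin \o g),
               C2_on (Rplus R) g,
               forall x, Rplus R x -> 0 < g x,
               forall x, Rplus R x -> g^`() x < 0 &
               forall x, Rplus R x -> (g^`(2))%classic x + (g^`())%classic x < 0]].
Arguments calF : clear implicits.

Lemma phi0_ge1 (R : realType) (x : R) : 0 <= x -> 1 <= phi0 x.
Proof.
move=> x0; rewrite /phi0.
have h : 1 <= Num.sqrt (x ^+ 2 / 4 + 1).
  have s0 : 0 <= x ^+ 2 / 4 by rewrite divr_ge0 // sqr_ge0.
  by rewrite -[leLHS]sqrtr1 ler_wsqrtr // lerDr.
by lra.
Qed.

Lemma phi0M1 (R : realType) (x : R) : phi0 x * phi1 x = 1.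
Proof.
rewrite /phi0 /phi1.
have h : Num.sqrt (x ^+ 2 / 4 + 1) ^+ 2 = x ^+ 2 / 4 + 1.
  by rewrite sqr_sqrtr // addr_ge0 // divr_ge0 // sqr_ge0.
by move: h; set s := Num.sqrt _ => h; lra.
Qed.

Lemma phi1E (R : realType) (x : R) : 0 <= x -> phi1 x = (phi0 x)^-1.
Proof.
move=> x0; have p0 : phi0 x != 0 by rewrite gt_eqF // (lt_le_trans _ (phi0_ge1 x0)).
by apply: (mulfI p0); rewrite phi0M1 divff.
Qed.

Lemma phi0B1 (R : realType) (x : R) : phi0 x - phi1 x = x.
Proof. by rewrite /phi0 /phi1; lra. Qed.

Lemma phi1_in (R : realType) (x : R) : 0 <= x -> 0 < phi1 x <= 1.
Proof.
move=> x0; have p1 := phi0_ge1 x0.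
have p0 : 0 < phi0 x by exact: lt_le_trans p1.
by rewrite phi1E // invr_gt0 p0 invf_le1.
Qed.

Lemma Ttilde_preimage (R : realType) (x y : R) : 0 < x -> 0 < y ->
  Ttilde y = x <-> y = phi0 x \/ y = phi1 x.
Proof.
move=> x0 y0; have p1 := phi0_ge1 (ltW x0).
have p0 : 0 < phi0 x by exact: lt_le_trans p1.
have pB := phi0B1 x; have pM := phi0M1 x.
have q0 : 0 < phi1 x by case/andP: (phi1_in (ltW x0)).
have yV : y * y^-1 = 1 by rewrite divff // gt_eqF.
have yV0 : 0 < y^-1 by rewrite invr_gt0.
rewrite /Ttilde; split.
  case: ifPn => _ e.
    left; have : (y - phi0 x) * (y + phi1 x) = 0 by nra.
    by move=> /eqP; rewrite mulf_eq0 => /orP[|] /eqP; lra.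
  right; have : (y - phi1 x) * (y + phi0 x) = 0 by nra.
  by move=> /eqP; rewrite mulf_eq0 => /orP[|] /eqP; lra.
case=> ->; first by rewrite p1 -phi1E ?ltW.
have -> : (1 <= phi1 x) = false by apply/negbTE; rewrite -ltNge; nra.
by rewrite phi1E ?ltW // invrK -phi1E ?ltW.
Qed.

(* Main.v *)
Require Import Defs.
From mathcomp Require Import all_boot all_order all_algebra.
From mathcomp Require Import all_classical all_reals all_analysis.
From mathcomp Require Import measurable_realfun.
From mathcomp Require Import ring lra.

Set Implicit Arguments.
Unset Strict Implicit.
Unset Printing Implicit Defensive.

Import Order.TTheory GRing.Theory Num.Theory.
Import numFieldNormedType.Exports.

Local Open Scope ring_scope.
Local Open Scope classical_set_scope.

(** Write p = phi0 x and q = phi1 x, so that p q = 1 and p - q = x, and put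
    w = 1 / (p + q).  Then p' = w p, q' = - w q and w' = - x w^3, whence
    P g = w p g(p) + w q g(q) and
<<
      (P g)'  = 2 w^3 (g p - g q) + (w p)^2 g' p - (w q)^2 g' q,
      (P g)'' = - 6 x w^5 (g p - g q) + 6 w^4 (p g' p + q g' q)
                + (w p)^3 g'' p + (w q)^3 g'' q.
>>
    Let D = g q - g p, a = - g' p > 0 and b = - g' q > 0.  The condition
    g'' + g' < 0 is used in two ways.  Pointwise, it gives g'' p < a and
    g'' q < b.  Integrated, it says that g' + g is decreasing, so that q < p
    yields D > b - a.  Hence - (P g)' is larger than a linear form in a and b,
    and so is - ((P g)'' + (P g)') since the coefficient of D in it is
    positive.  The coefficients of both forms are rational functions of p that
    are positive for p > 1 (lemmas [Ptilde1_form_lt0] and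
    [Ptilde2_form_lt0]).

    For integrability, the changes of variables y = p and y = q turn the
    integral of each term of P g over a segment of R^+ into the integral of g
    over a segment of R^+, which is at most the integral of g over R^+;
    monotone convergence along an exhaustion of R^+ by segments concludes
    (lemma [integrable_Ptilde]). *)

(** * Derivatives of the transfer operator *)

Lemma is_derive_continuous (R : realType) (f : R -> R) (x d : R) :
  is_derive x 1 f d -> {for x, continuous f}.
Proof.
by move=> [df _]; apply: differentiable_continuous; exact/derivable1_diffP.
Qed.

(** The reciprocal of phi0 x + phi1 x; multiplied by phi0 x, resp. phi1 x, it
    is the absolute value of the derivative of that branch. *)
Definition branch_weight (R : realType) (x : R) : R :=
  (2 * Num.sqrt (x ^+ 2 / 4 + 1))^-1.

Section branches.
Context {R : realType}.
Implicit Types (x : R) (g : R -> R).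
Local Notation p := (@phi0 R).
Local Notation q := (@phi1 R).
Local Notation w := (@branch_weight R).

Let radicand_gt0 x : 0 < x ^+ 2 / 4 + 1.
Proof. by have := sqr_ge0 x; lra. Qed.

Lemma branch_weight_gt0 x : 0 < w x.
Proof. by rewrite invr_gt0 mulr_gt0// sqrtr_gt0. Qed.

Lemma branch_weightMD x : w x * (p x + q x) = 1.
Proof.
have s0 : 0 < Num.sqrt (x ^+ 2 / 4 + 1) by rewrite sqrtr_gt0.
rewrite /branch_weight /phi0 /phi1; set s := Num.sqrt _ in s0 *.
by field; rewrite gt_eqF.
Qed.

Lemma phi0_gt0 x : 0 < p x.
Proof.
have s0 : 0 < p x + q x.
  by rewrite -(pmulr_rgt0 _ (branch_weight_gt0 x)) branch_weightMD.
have pq := phi0M1 x; rewrite ltNge; apply/negP => p0.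
by have q0 : 0 < q x; nra.
Qed.

Lemma phi1_gt0 x : 0 < q x.
Proof. by rewrite -(pmulr_rgt0 _ (phi0_gt0 x)) phi0M1. Qed.

Lemma is_derive_sqrt_radicand x :
  is_derive x 1 (fun y => Num.sqrt (y ^+ 2 / 4 + 1)) (w x * x / 2).
Proof.
have h := radicand_gt0 x.
have d : is_derive x 1 (fun y : R => y ^+ 2 / 4 + 1) (x / 2).
  apply: is_derive_eq.
  by rewrite /GRing.scale/= ?expr1; lra.
have d' := @is_derive1_comp _ Num.sqrt _ x _ _ (is_derive1_sqrt h) d.
by apply: (is_derive_eq d'); rewrite /branch_weight mulrA.
Qed.

Lemma is_derive_phi0 x : is_derive x 1 p (w x * p x).
Proof.
have d := is_derive_sqrt_radicand x.
apply: is_derive_eq.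
have := branch_weightMD x; have := phi0B1 x.
by rewrite /GRing.scale/=; nra.
Qed.

Lemma is_derive_phi1 x : is_derive x 1 q (- (w x * q x)).
Proof.
have d := is_derive_sqrt_radicand x.
apply: is_derive_eq.
have := branch_weightMD x; have := phi0B1 x.
by rewrite /GRing.scale/=; nra.
Qed.

Lemma is_derive_branch_weight x : is_derive x 1 w (- (x * w x ^+ 3)).
Proof.
have s0 : 0 < Num.sqrt (x ^+ 2 / 4 + 1) by rewrite sqrtr_gt0.
have d := is_derive_sqrt_radicand x.
have d' : is_derive x 1 (fun y => 2 * Num.sqrt (y ^+ 2 / 4 + 1)) (w x * x).
  by apply: is_derive_eq; rewrite /GRing.scale/=; lra.
apply: is_derive_eq (is_deriveV _ d') _.
  by rewrite gt_eqF // mulr_gt0.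
by rewrite -exprVn -/(w x) /GRing.scale/=; ring.
Qed.

Lemma PtildeE g x :
  Ptilde g x = w x * p x * g (p x) + w x * q x * g (q x).
Proof.
rewrite /Ptilde !derive1E (derive_val (is_derive := is_derive_phi0 x)).
rewrite (derive_val (is_derive := is_derive_phi1 x)) normrN.
by rewrite !gtr0_norm // mulr_gt0 // ?branch_weight_gt0 ?phi0_gt0 ?phi1_gt0.
Qed.

(** The derivative of [Ptilde g] when g is differentiable on R^+. *)
Definition Ptilde1 g x : R :=
  2 * w x ^+ 3 * (g (p x) - g (q x)) +
  ((w x * p x) ^+ 2 * derive1 g (p x) - (w x * q x) ^+ 2 * derive1 g (q x)).

(** The second derivative of [Ptilde g] when g is twice differentiable on
    R^+. *)
Definition Ptilde2 g x : R :=
  - (6 * x * w x ^+ 5) * (g (p x) - g (q x)) +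
  6 * w x ^+ 4 * (p x * derive1 g (p x) + q x * derive1 g (q x)) +
  ((w x * p x) ^+ 3 * derive1n 2 g (p x) +
   (w x * q x) ^+ 3 * derive1n 2 g (q x)).

Let is_derive_comp_phi0 g x : derivable g (p x) 1 ->
  is_derive x 1 (fun y => g (p y)) (derive1 g (p x) * (w x * p x)).
Proof.
move=> /derivableP; rewrite -derive1E => dg.
exact: (@is_derive1_comp _ g p x _ _ dg (is_derive_phi0 x)).
Qed.

Let is_derive_comp_phi1 g x : derivable g (q x) 1 ->
  is_derive x 1 (fun y => g (q y)) (- (derive1 g (q x) * (w x * q x))).
Proof.
move=> /derivableP; rewrite -derive1E => dg; rewrite -mulrN.
exact: (@is_derive1_comp _ g q x _ _ dg (is_derive_phi1 x)).
Qed.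

(** By p q = 1, x = p - q and w (p + q) = 1, the functions w p and w q have
    opposite derivatives. *)
Let is_derive_wp x : is_derive x 1 (fun y => w y * p y) (2 * w x ^+ 3).
Proof.
have := is_derive_phi0 x; have := is_derive_branch_weight x => dw d3.
apply: is_derive_eq.
have := branch_weightMD x; have := phi0B1 x; have := phi0M1 x.
rewrite /GRing.scale/=.
move: (p x) (q x) (w x) => P Q W PQ xE WE.
have -> : W * (W * P) = W * (W * P) * (W * (P + Q)) by rewrite WE mulr1.
have -> : 2 * W ^+ 3 = 2 * W ^+ 3 * (P * Q) by rewrite PQ mulr1.
by rewrite -xE; ring.
Qed.

Let is_derive_wq x : is_derive x 1 (fun y => w y * q y) (- (2 * w x ^+ 3)).
Proof.
have := is_derive_phi1 x; have := is_derive_branch_weight x => dw d3.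
apply: is_derive_eq.
have := branch_weightMD x; have := phi0B1 x; have := phi0M1 x.
rewrite /GRing.scale/=.
move: (p x) (q x) (w x) => P Q W PQ xE WE.
have -> : W * (- (W * Q)) = - (W * (W * Q)) * (W * (P + Q)).
  by rewrite WE mulr1 mulrN.
have -> : 2 * W ^+ 3 = 2 * W ^+ 3 * (P * Q) by rewrite PQ mulr1.
by rewrite -xE; ring.
Qed.

Lemma is_derive_Ptilde g x : derivable g (p x) 1 -> derivable g (q x) 1 ->
  is_derive x 1 (Ptilde g) (Ptilde1 g x).
Proof.
move=> dp dq; have d0 := is_derive_comp_phi0 dp.
have d1 := is_derive_comp_phi1 dq.
have := is_derive_wp x; have := is_derive_wq x => dwq dwp.
have -> : Ptilde g = (fun y => w y * p y * g (p y) + w y * q y * g (q y)).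
  by apply/funext => y; exact: PtildeE.
apply: is_derive_eq; rewrite /Ptilde1 /GRing.scale/=; ring.
Qed.

Lemma is_derive_Ptilde1 g x :
  derivable g (p x) 1 -> derivable g (q x) 1 ->
  derivable (derive1 g) (p x) 1 -> derivable (derive1 g) (q x) 1 ->
  is_derive x 1 (Ptilde1 g) (Ptilde2 g x).
Proof.
move=> dp dq dp' dq'; have d0 := is_derive_comp_phi0 dp.
have d1 := is_derive_comp_phi1 dq.
have d2 := is_derive_comp_phi0 dp'.
have d3 := is_derive_comp_phi1 dq'.
have := is_derive_wp x; have := is_derive_wq x.
have := is_derive_branch_weight x => dw dwq dwp.
rewrite /Ptilde1; apply: is_derive_eq.
rewrite /Ptilde2 /GRing.scale/=.
move: (p x) (q x) (w x) (g (p x)) (g (q x)) => P Q W a b.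
set a2 := derive1 (derive1 g) P; set b2 := derive1 (derive1 g) Q.
move: a2 b2 (derive1 g P) (derive1 g Q) => a2 b2 a1 b1.
ring.
Qed.

Lemma continuous_Ptilde2 g x :
  {for p x, continuous g} -> {for q x, continuous g} ->
  {for p x, continuous (derive1 g)} -> {for q x, continuous (derive1 g)} ->
  {for p x, continuous (derive1n 2 g)} ->
  {for q x, continuous (derive1n 2 g)} ->
  {for x, continuous (Ptilde2 g)}.
Proof.
have cw := is_derive_continuous (is_derive_branch_weight x).
have cp := is_derive_continuous (is_derive_phi0 x).
have cq := is_derive_continuous (is_derive_phi1 x).
have cpc (h : R -> R) : {for p x, continuous h} ->
  {for x, continuous (fun y => h (p y))} by exact: continuous_comp.
have cqc (h : R -> R) : {for q x, continuous h} ->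
  {for x, continuous (fun y => h (q y))} by exact: continuous_comp.
move=> /cpc c1 /cqc c2 /cpc c3 /cqc c4 /cpc c5 /cqc c6.
have cx : {for x, continuous (@id R)} by apply: cvg_id.
have cX (f : R -> R) n : {for x, continuous f} ->
    {for x, continuous (fun y => f y ^+ n)}.
  move=> cf; apply: (@continuous_comp _ _ _ f (fun z => z ^+ n) x cf).
  exact: exprn_continuous.
have cM (f h : R -> R) : {for x, continuous f} -> {for x, continuous h} ->
  {for x, continuous (fun y => f y * h y)} by move=> *; exact: continuousM.
have cD (f h : R -> R) : {for x, continuous f} -> {for x, continuous h} ->
  {for x, continuous (fun y => f y + h y)} by move=> *; exact: continuousD.
have cN (f : R -> R) : {for x, continuous f} ->
  {for x, continuous (fun y => - f y)} by move=> *; exact: continuousN.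
have cc (k : R) : {for x, continuous (fun y : R => k)} by apply: cvg_cst.
have T1 := cM _ _ (cN _ (cM _ _ (cM _ _ (cc 6) cx) (cX _ 5 cw)))
  (cD _ _ c1 (cN _ c2)).
have T2 := cM _ _ (cM _ _ (cc 6) (cX _ 4 cw))
  (cD _ _ (cM _ _ cp c3) (cM _ _ cq c4)).
have T3 := cD _ _ (cM _ _ (cX _ 3 (cM _ _ cw cp)) c5)
  (cM _ _ (cX _ 3 (cM _ _ cw cq)) c6).
exact: (cD _ _ (cD _ _ T1 T2) T3).
Qed.

End branches.

(** * Signs of the derivatives *)

Section sign_analysis.
Context {R : realType}.
Variables p q w : R.
Hypotheses (q_gt0 : 0 < q) (w_gt0 : 0 < w) (qp : q < p).
Hypotheses (pq1 : p * q = 1) (wpq1 : w * (p + q) = 1).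

Let p_gt1 : 1 < p.
Proof.
have [//|h] := ltP 1 p.
have : (1 - p) * q >= 0 by rewrite mulr_ge0 ?subr_ge0 // ltW.
move=> h'; have := pq1; have := qp; lra.
Qed.

Let q_lt1 : q < 1.
Proof.
have [//|h] := ltP q 1.
by have : 0 < (p - 1) * q; [rewrite mulr_gt0 // subr_gt0 | have := pq1; lra].
Qed.

Let q3_lt1 : q ^+ 3 < 1.
Proof. by rewrite exprn_ilt1 // ltW. Qed.

Let p3_gt1 : 1 < p ^+ 3.
Proof. by rewrite exprn_egt1. Qed.

(** The formula for (P g)' with D = g q - g p, a = - g' p and b = - g' q.
    Replacing D by its lower bound b - a leaves, up to the factor
    - w^2, the coefficients p^2 - 2 w of a and 2 w - q^2 of b. *)
Lemma Ptilde1_form_lt0 (D a b : R) : 0 < a -> 0 < b -> b - a < D ->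
  2 * w ^+ 3 * (- D) + ((w * p) ^+ 2 * (- a) - (w * q) ^+ 2 * (- b)) < 0.
Proof.
move=> a0 b0 baD.
have c1 : 0 < 2 * w - q ^+ 2.
  have -> : 2 * w - q ^+ 2 = w * (2 - q ^+ 2 * p - q ^+ 3).
    transitivity (2 * w - q ^+ 2 * (w * (p + q))); first by rewrite wpq1 mulr1.
    ring.
  have -> : q ^+ 2 * p = q by rewrite expr2 -mulrA (mulrC q p) pq1 mulr1.
  by apply: mulr_gt0 => //; have := q_lt1; have := q3_lt1; lra.
have c2 : 0 < p ^+ 2 - 2 * w.
  have -> : p ^+ 2 - 2 * w = w * (p ^+ 3 + p ^+ 2 * q - 2).
    transitivity (p ^+ 2 * (w * (p + q)) - 2 * w); first by rewrite wpq1 mulr1.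
    ring.
  have -> : p ^+ 2 * q = p by rewrite expr2 -mulrA pq1 mulr1.
  by apply: mulr_gt0 => //; have := p_gt1; have := p3_gt1; lra.
have c3 : 0 < w * (D - (b - a)) by rewrite mulr_gt0 // subr_gt0.
have c4 := mulr_gt0 c1 b0; have c5 := mulr_gt0 c2 a0.
have -> : 2 * w ^+ 3 * (- D) + ((w * p) ^+ 2 * (- a) - (w * q) ^+ 2 * (- b)) =
  - (w ^+ 2 * (2 * (w * (D - (b - a))) + (2 * w - q ^+ 2) * b +
     (p ^+ 2 - 2 * w) * a)) by ring.
by rewrite oppr_lt0 mulr_gt0 ?exprn_gt0 //; lra.
Qed.

(** The formula for (P g)'' + (P g)', with D, a and b as above, a2 = g'' p,
    b2 = g'' q and x = p - q. *)
Lemma Ptilde2_form_lt0 (D a b a2 b2 : R) :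
  0 < a -> 0 < b -> b - a < D -> a2 < a -> b2 < b ->
  (- (6 * (p - q) * w ^+ 5) * (- D) +
    6 * w ^+ 4 * (p * (- a) + q * (- b)) +
    ((w * p) ^+ 3 * a2 + (w * q) ^+ 3 * b2)) +
  (2 * w ^+ 3 * (- D) + ((w * p) ^+ 2 * (- a) - (w * q) ^+ 2 * (- b))) < 0.
Proof.
move=> a0 b0 baD a2a b2b.
(* After replacing a2 by a and b2 by b, the opposite of the left-hand side is
   K D + A a + B b; then D is replaced by b - a. *)
pose K := 2 * w ^+ 3 - 6 * (p - q) * w ^+ 5.
pose A := 6 * w ^+ 4 * p + (w * p) ^+ 2 - (w * p) ^+ 3.
pose B := 6 * w ^+ 4 * q - (w * q) ^+ 2 - (w * q) ^+ 3.
pose c := w * q.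
have c_gt0 : 0 < c by rewrite mulr_gt0.
(* c = 1 / (1 + p^2) *)
have wE : w = p * c by rewrite /c mulrCA pq1 mulr1.
have cp : c * (1 + p ^+ 2) = 1.
  transitivity (w * (p * (p * q) + q)); first by rewrite /c; ring.
  by rewrite pq1 mulr1.
have p_gt0 : 0 < p by exact: lt_trans p_gt1.
have p1 := p_gt1; have pq_lt := qp.
(* By w (p + q) = 1 and (p + q)^2 = x^2 + 4, the sign of K is that of
   2 x^2 - 6 x + 8. *)
have K_gt0 : 0 < K.
  have -> : K = w ^+ 5 * (2 * (p + q) ^+ 2 - 6 * (p - q)).
    transitivity (2 * w ^+ 3 * (w * (p + q)) ^+ 2 - 6 * (p - q) * w ^+ 5).
      by rewrite wpq1 expr1n mulr1.
    by ring.
  rewrite mulr_gt0 ?exprn_gt0 //.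
  have -> : (p + q) ^+ 2 = (p - q) ^+ 2 + 4 * (p * q) by ring.
  by rewrite pq1; have := sqr_ge0 (p - q - 3 / 2); nra.
have AK : 0 < A - K.
  have -> : A - K = w ^+ 3 * (6 * (w * p) + p - 2 + 6 * (p - q) * w ^+ 2).
    rewrite /A /K.
    have -> : (w * p) ^+ 2 = w ^+ 3 * p ^+ 3 + w ^+ 3 * p.
      transitivity ((w * p) ^+ 2 * (w * (p + q))); first by rewrite wpq1 mulr1.
      transitivity (w ^+ 3 * p ^+ 3 + w ^+ 3 * p * (p * q)); first by ring.
      by rewrite pq1 mulr1.
    by ring.
  have wp : 1 / 2 < w * p.
    have : 0 < w * (p - q) by rewrite mulr_gt0 ?subr_gt0.
    by have := wpq1; rewrite !mulrDr mulrN; lra.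
  have : 0 < (p - q) * w ^+ 2 by rewrite mulr_gt0 ?subr_gt0 ?exprn_gt0.
  by move=> h; rewrite mulr_gt0 ?exprn_gt0 //; lra.
(* Over the common denominator (1 + p^2)^5, K + B is a polynomial in p, which is
   positive for p > 1; B alone changes sign. *)
have KB : 0 < K + B.
  have -> : K + B = c ^+ 5 * (2 * p ^+ 7 - 7 * p ^+ 6 + 10 * p ^+ 5 +
      2 * p ^+ 4 + 8 * p ^+ 3 - 5 * p ^+ 2 - 2).
    rewrite /K /B -/c.
    transitivity (2 * p ^+ 3 * c ^+ 3 * (c * (1 + p ^+ 2)) ^+ 2
       - 6 * (p ^+ 2 - p * q) * p ^+ 4 * c ^+ 5
       + 6 * p ^+ 3 * c ^+ 3 * (p * q) * c * (c * (1 + p ^+ 2))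
       - c ^+ 2 * (c * (1 + p ^+ 2)) ^+ 3 - c ^+ 3 * (c * (1 + p ^+ 2)) ^+ 2).
      by rewrite cp wE !expr1n !mulr1; ring.
    by rewrite pq1; ring.
  rewrite mulr_gt0 ?exprn_gt0 //.
  have h1 : 0 < p ^+ 5 * (2 * p ^+ 2 - 7 * p + 10).
    rewrite mulr_gt0 ?exprn_gt0 //.
    by have := sqr_ge0 (p - 7 / 4); nra.
  have h2 : 0 < p ^+ 2 * (p - 1) by rewrite mulr_gt0 ?exprn_gt0 ?subr_gt0.
  have h3 : 0 < p ^+ 4 by rewrite exprn_gt0.
  have h4 : 1 < p ^+ 2 by nra.
  have h5 : p ^+ 3 = p ^+ 2 * p by rewrite exprSr.
  have h6 : p ^+ 7 = p ^+ 5 * p ^+ 2 by rewrite -exprD.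
  have h7 : p ^+ 6 = p ^+ 5 * p by rewrite -exprSr.
  by rewrite h5 h6 h7; lra.
have e1 := mulr_gt0 AK a0; have e2 := mulr_gt0 KB b0.
have e3 : 0 < K * (D - (b - a)) by rewrite mulr_gt0 // subr_gt0.
have e4 : 0 < (w * p) ^+ 3 * (a - a2).
  by rewrite mulr_gt0 ?exprn_gt0 ?mulr_gt0 // subr_gt0.
have e5 : 0 < (w * q) ^+ 3 * (b - b2).
  by rewrite mulr_gt0 ?exprn_gt0 ?mulr_gt0 // subr_gt0.
rewrite -oppr_gt0; set E := - _.
have -> : E = (A - K) * a + (K + B) * b + K * (D - (b - a)) +
  (w * p) ^+ 3 * (a - a2) + (w * q) ^+ 3 * (b - b2).
  by rewrite /E /A /K /B; ring.
by lra.
Qed.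

End sign_analysis.

(** * Integrability *)

Section integrability.
Context {R : realType}.
Implicit Types (x : R) (g : R -> R).
Local Notation mu := (@lebesgue_measure R).
Local Notation p := (@phi0 R).
Local Notation q := (@phi1 R).
Local Notation w := (@branch_weight R).

Lemma RplusE x : Rplus R x = (0 < x).
Proof. by rewrite /Rplus /= in_itv /= andbT. Qed.

Lemma Rplus_bigcup :
  Rplus R = \bigcup_n `[n.+1%:R^-1, n.+1%:R]%classic.
Proof.
apply/seteqP; split => x; last first.
  move=> [n _] /=; rewrite in_itv /= => /andP[nx _].
  by rewrite RplusE (lt_le_trans _ nx).
rewrite RplusE => x0.
pose m := maxn (Num.truncn x) (Num.truncn x^-1).
exists m => //=; rewrite in_itv /=.
have h (y : R) : (Num.truncn y <= m)%N -> y <= m.+1%:R.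
  by move=> ym; rewrite (le_trans (ltW (truncnS_gt y))) // ler_nat.
apply/andP; split; last by rewrite h ?leq_maxl.
by rewrite -[leRHS]invrK lef_pV2 ?posrE ?invr_gt0 // h ?leq_maxr.
Qed.

(** A nonnegative continuous function on R^+ whose integrals over all segments
    have a common finite bound is integrable. *)
Lemma integrable_Rplus_exhaustion (f : R -> R) (M : \bar R) :
  (forall x, 0 < x -> {for x, continuous f}) -> (forall x, 0 < x -> 0 <= f x) ->
  (M < +oo)%E ->
  (forall a b, 0 < a -> a <= b -> (\int[mu]_(x in `[a, b]) (f x)%:E <= M)%E) ->
  mu.-integrable (Rplus R) (EFin \o f).
Proof.
move=> cf f0 Moo fM.
have mf : measurable_fun (Rplus R) f.
  apply: open_continuous_measurable_fun; first exact: interval_open.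
  by move=> x; rewrite inE RplusE => /cf.
have mRp : measurable (Rplus R) by exact: measurable_itv.
apply/integrableP; split; first exact/measurable_EFinP.
under eq_integral => x xp.
  rewrite /= ger0_norm; last by apply: f0; move: xp; rewrite inE RplusE.
  over.
apply: le_lt_trans Moo.
pose E n := `[n.+1%:R^-1, n.+1%:R : R]%classic.
have En n : E n `<=` Rplus R by rewrite Rplus_bigcup => x Ex; exists n.
have ndE : nondecreasing_seq E.
  move=> m n mn; apply/subsetPset => x; rewrite /E /= !in_itv /=.
  move=> /andP[mx xm]; apply/andP; split.
    by rewrite (le_trans _ mx) // lef_pV2 ?posrE // ler_nat ltnS.
  by rewrite (le_trans xm) // ler_nat ltnS.
have mE n : measurable (E n) by exact: measurable_itv.
have mfE n : measurable_fun (E n) (EFin \o f).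
  by apply/measurable_EFinP; exact: measurable_funS mf.
have f0E n x : E n x -> (0 <= (EFin \o f) x)%E.
  by move=> /En; rewrite RplusE lee_fin => /f0.
have := @ge0_nondecreasing_set_cvg_integral _ (measurableTypeR R) R E (EFin \o f)
  lebesgue_measure ndE mE mfE f0E.
rewrite -Rplus_bigcup => /cvge_to_le; apply.
apply: nearW => n; apply: fM => //.
have n1 : 1 <= n.+1%:R :> R by rewrite ler1n.
by rewrite (le_trans _ n1) // invf_le1.
Qed.

Lemma integral_itv_le_Rplus g (a b : R) :
  (forall x, 0 < x -> {for x, continuous g}) -> (forall x, 0 < x -> 0 <= g x) ->
  0 < a ->
  (\int[mu]_(x in `[a, b]) (g x)%:E <= \int[mu]_(x in Rplus R) (g x)%:E)%E.
Proof.
move=> cg g0 a0; have mg : measurable_fun (Rplus R) g.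
  apply: open_continuous_measurable_fun; first exact: interval_open.
  by move=> x; rewrite inE RplusE => /cg.
apply: ge0_subset_integral => //.
- exact: measurable_itv.
- exact/measurable_EFinP.
- by move=> x; rewrite RplusE lee_fin => /g0.
- move=> x /=; rewrite in_itv /= => /andP[ax _].
  by rewrite RplusE (lt_le_trans a0).
Qed.

Lemma lt_of_derive_lt0 (f df : R -> R) (a b : R) : a < b ->
  (forall x, a <= x -> x <= b -> is_derive x 1 f (df x)) ->
  (forall x, a < x -> x < b -> df x < 0) -> f b < f a.
Proof.
move=> ab fdf df0.
have [||c cab e] := @MVT _ f df a b ab.
- by move=> x; rewrite in_itv /= => /andP[ax xb]; apply: fdf; exact: ltW.
- apply: derivable_within_continuous => x; rewrite in_itv /= => /andP[ax xb].
  by have [] := fdf x ax xb.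
move: cab; rewrite in_itv /= => /andP[ac cb].
by rewrite -subr_lt0 e nmulr_rlt0 ?df0 // subr_gt0.
Qed.

Lemma derive_oo_LRcontinuous_of_is_derive (F dF : R -> R) (a b : R) :
  (forall x, is_derive x 1 F (dF x)) -> derivable_oo_LRcontinuous F a b.
Proof.
move=> FdF; have cF x : {for x, continuous F} by exact: is_derive_continuous.
split; first by move=> x _; case: (FdF x).
  exact/cvg_at_right_filter/cF.
exact/cvg_at_left_filter/cF.
Qed.

Lemma integration_by_smooth_substitution_increasing
    (F dF G : R -> R) (a b : R) :
  (forall x, is_derive x 1 F (dF x)) -> continuous dF ->
  (forall x, 0 < dF x) -> a <= b -> {within `[F a, F b], continuous G} ->
  (\int[mu]_(x in `[F a, F b]) (G x)%:E =
   \int[mu]_(x in `[a, b]) (dF x * G (F x))%:E)%E.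
Proof.
move=> FdF cdF dF0 ab cG.
have F'E : F^`()%classic = dF.
  by apply/funext => x; rewrite derive1E; case: (FdF x).
rewrite integration_by_substitution_increasing //.
- by apply: eq_integral => x _; rewrite F'E /= mulrC.
- move=> x y _ _ xy; rewrite -ltrN2.
  apply: (@lt_of_derive_lt0 (- F) (- dF)) => //.
  by move=> z _ _; rewrite opprfctE oppr_lt0.
- by move=> x _; rewrite F'E; exact: cdF.
- by rewrite F'E; apply/cvg_ex; exists (dF a); exact/cvg_at_right_filter/cdF.
- by rewrite F'E; apply/cvg_ex; exists (dF b); exact/cvg_at_left_filter/cdF.
- exact: derive_oo_LRcontinuous_of_is_derive FdF.
Qed.

Lemma integration_by_smooth_substitution_decreasing
    (F dF G : R -> R) (a b : R) :
  (forall x, is_derive x 1 F (- dF x)) -> continuous dF ->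
  (forall x, 0 < dF x) -> a <= b -> {within `[F b, F a], continuous G} ->
  (\int[mu]_(x in `[F b, F a]) (G x)%:E =
   \int[mu]_(x in `[a, b]) (dF x * G (F x))%:E)%E.
Proof.
move=> FdF cdF dF0 ab cG.
have F'E : F^`()%classic = - dF.
  by apply/funext => x; rewrite derive1E; case: (FdF x).
have cF' : continuous (- dF) by move=> x; apply: continuousN; exact: cdF.
rewrite integration_by_substitution_decreasing //.
- by apply: eq_integral => x _; rewrite F'E opprK /= mulrC.
- move=> x y _ _ xy.
  apply: (@lt_of_derive_lt0 F (fun z => - dF z)) => //.
  by move=> z _ _; rewrite oppr_lt0.
- by move=> x _; rewrite F'E; exact: cF'.
- by rewrite F'E; apply/cvg_ex; exists (- dF a); exact/cvg_at_right_filter/cF'.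
- by rewrite F'E; apply/cvg_ex; exists (- dF b); exact/cvg_at_left_filter/cF'.
- exact: derive_oo_LRcontinuous_of_is_derive FdF.
Qed.

Let continuous_wphi0 : continuous (fun x => w x * p x).
Proof.
move=> x; apply: continuousM.
  exact: is_derive_continuous (is_derive_branch_weight x).
exact: is_derive_continuous (is_derive_phi0 x).
Qed.

Let continuous_wphi1 : continuous (fun x => w x * q x).
Proof.
move=> x; apply: continuousM.
  exact: is_derive_continuous (is_derive_branch_weight x).
exact: is_derive_continuous (is_derive_phi1 x).
Qed.

Lemma integral_phi0_le g (a b : R) :
  (forall x, 0 < x -> {for x, continuous g}) -> (forall x, 0 < x -> 0 <= g x) ->
  a <= b -> (\int[mu]_(x in `[a, b]) (w x * p x * g (p x))%:E
    <= \int[mu]_(x in Rplus R) (g x)%:E)%E.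
Proof.
move=> cg g0 ab.
rewrite -(@integration_by_smooth_substitution_increasing p
  (fun x => w x * p x) g a b (@is_derive_phi0 R)) //.
- exact/integral_itv_le_Rplus/phi0_gt0.
- by move=> x; rewrite mulr_gt0 ?branch_weight_gt0 ?phi0_gt0.
- apply: continuous_in_subspaceT => x; rewrite inE /= in_itv /= => /andP[px _].
  by apply: cg; apply: lt_le_trans px; exact: phi0_gt0.
Qed.

Lemma integral_phi1_le g (a b : R) :
  (forall x, 0 < x -> {for x, continuous g}) -> (forall x, 0 < x -> 0 <= g x) ->
  a <= b -> (\int[mu]_(x in `[a, b]) (w x * q x * g (q x))%:E
    <= \int[mu]_(x in Rplus R) (g x)%:E)%E.
Proof.
move=> cg g0 ab.
rewrite -(@integration_by_smooth_substitution_decreasing q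
  (fun x => w x * q x) g a b (@is_derive_phi1 R)) //.
- exact/integral_itv_le_Rplus/phi1_gt0.
- by move=> x; rewrite mulr_gt0 ?branch_weight_gt0 ?phi1_gt0.
- apply: continuous_in_subspaceT => x; rewrite inE /= in_itv /= => /andP[qx _].
  by apply: cg; apply: lt_le_trans qx; exact: phi1_gt0.
Qed.

Lemma integrable_Ptilde g :
  (forall x, 0 < x -> {for x, continuous g}) -> (forall x, 0 < x -> 0 <= g x) ->
  mu.-integrable (Rplus R) (EFin \o g) ->
  mu.-integrable (Rplus R) (EFin \o Ptilde g).
Proof.
move=> cg g0 ig.
have Moo : (\int[mu]_(x in Rplus R) (g x)%:E < +oo)%E.
  by have /integral_fune_lt_pinfty := ig; apply; exact: measurable_itv.
have i0 : mu.-integrable (Rplus R) (EFin \o (fun x => w x * p x * g (p x))).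
  apply: (integrable_Rplus_exhaustion _ _ Moo).
  - move=> x _; apply: continuousM; first exact: continuous_wphi0.
    apply: continuous_comp; last exact/cg/phi0_gt0.
    exact: is_derive_continuous (is_derive_phi0 x).
  - move=> x _.
    rewrite mulr_ge0 ?g0 ?phi0_gt0 // mulr_ge0 // ltW //.
      exact: branch_weight_gt0.
    exact: phi0_gt0.
  - by move=> a b _; exact: integral_phi0_le.
have i1 : mu.-integrable (Rplus R) (EFin \o (fun x => w x * q x * g (q x))).
  apply: (integrable_Rplus_exhaustion _ _ Moo).
  - move=> x _; apply: continuousM; first exact: continuous_wphi1.
    apply: continuous_comp; last exact/cg/phi1_gt0.
    exact: is_derive_continuous (is_derive_phi1 x).
  - move=> x _.
    rewrite mulr_ge0 ?g0 ?phi1_gt0 // mulr_ge0 // ltW //.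
      exact: branch_weight_gt0.
    exact: phi1_gt0.
  - by move=> a b _; exact: integral_phi1_le.
have mRp : measurable (Rplus R) by exact: measurable_itv.
have -> : EFin \o Ptilde g =
    (fun x => (w x * p x * g (p x))%:E + (w x * q x * g (q x))%:E)%E.
  by apply/funext => x; rewrite /= PtildeE EFinD.
exact: integrableD.
Qed.

End integrability.

Theorem lemma10 (R : realType) : (@Ptilde R) @` (calF R) `<=` calF R.
Proof.
move=> _ [g [ig C2g g_gt0 g'_lt0 g''_lt0] <-].
have dg (x : R) : 0 < x -> is_derive x 1 g (derive1 g x).
  by rewrite -RplusE => /C2g[dg _ _]; rewrite derive1E; exact: derivableP.
have dg' (x : R) : 0 < x -> is_derive x 1 (derive1 g) (derive1n 2 g x).
  by rewrite -RplusE => /C2g[_ /derivableP + _]; rewrite -derive1E.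
have cg'' (x : R) : 0 < x -> {for x, continuous (derive1n 2 g)}.
  by rewrite -RplusE => /C2g[].
have cg (x : R) : 0 < x -> {for x, continuous g}.
  by move=> /dg /is_derive_continuous.
have cg' (x : R) : 0 < x -> {for x, continuous (derive1 g)}.
  by move=> /dg' /is_derive_continuous.
(* Both branches map the whole real line into R^+, so the two derivative
   formulas hold at every real number and give equalities of functions. *)
have p0 := @phi0_gt0 R; have q0 := @phi1_gt0 R.
have dP (x : R) : is_derive x 1 (Ptilde g) (Ptilde1 g x).
  apply: is_derive_Ptilde.
    by case: (dg _ (p0 x)).
  by case: (dg _ (q0 x)).
have PE : derive1 (Ptilde g) = Ptilde1 g.
  by apply/funext => x; rewrite derive1E; case: (dP x).
have dP1 (x : R) : is_derive x 1 (Ptilde1 g) (Ptilde2 g x).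
  apply: is_derive_Ptilde1.
  - by case: (dg _ (p0 x)).
  - by case: (dg _ (q0 x)).
  - by case: (dg' _ (p0 x)).
  - by case: (dg' _ (q0 x)).
have PE2 : derive1n 2 (Ptilde g) = Ptilde2 g.
  by apply/funext => x; rewrite /= PE derive1E; case: (dP1 x).
have g_pos (x : R) : 0 < x -> 0 < g x by rewrite -RplusE; exact: g_gt0.
have g'_neg (x : R) : 0 < x -> derive1 g x < 0.
  by rewrite -RplusE; exact: g'_lt0.
have g''_neg (x : R) : 0 < x -> derive1n 2 g x + derive1 g x < 0.
  by rewrite -RplusE; exact: g''_lt0.
have qp (x : R) : 0 < x -> phi1 x < phi0 x.
  by move=> x0; rewrite -subr_gt0 phi0B1.
(* Since g' + g is decreasing. *)
have gap (x : R) : 0 < x ->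
    - derive1 g (phi1 x) - - derive1 g (phi0 x) < g (phi1 x) - g (phi0 x).
  move=> x0.
  suff : derive1 g (phi0 x) + g (phi0 x) < derive1 g (phi1 x) + g (phi1 x).
    by lra.
  apply: (@lt_of_derive_lt0 R (derive1 g \+ g) (derive1n 2 g \+ derive1 g));
    first exact: qp.
    move=> y qy _; have y0 := lt_le_trans (q0 x) qy.
    by apply: is_deriveD; [exact: dg'|exact: dg].
  by move=> y qy _; apply: g''_neg; exact: lt_trans qy.
have form (x : R) : 0 < x ->
    g (phi0 x) - g (phi1 x) = - (g (phi1 x) - g (phi0 x)).
  by rewrite opprB.
split.
- apply: integrable_Ptilde ig => // x /g_pos; exact: ltW.
- move=> x _; split.
  + by case: (dP x).
  + by rewrite PE; case: (dP1 x).
  + rewrite PE2.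
    exact: (continuous_Ptilde2 (cg _ (p0 x)) (cg _ (q0 x)) (cg' _ (p0 x))
      (cg' _ (q0 x)) (cg'' _ (p0 x)) (cg'' _ (q0 x))).
- move=> x _; rewrite PtildeE.
  by rewrite addr_gt0 // !mulr_gt0 ?branch_weight_gt0 ?g_pos.
- move=> x; rewrite RplusE => x0; rewrite PE /Ptilde1 form //.
  rewrite -[derive1 g (phi0 x)]opprK -[derive1 g (phi1 x)]opprK.
  by apply: Ptilde1_form_lt0; rewrite ?oppr_gt0 ?branch_weight_gt0 ?g'_neg ?qp
    ?phi0M1 ?branch_weightMD ?gap.
- move=> x; rewrite RplusE => x0; rewrite PE PE2 /Ptilde1 /Ptilde2 form //.
  rewrite -[derive1 g (phi0 x)]opprK -[derive1 g (phi1 x)]opprK.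
  rewrite -[X in 6 * X * _]phi0B1.
  apply: Ptilde2_form_lt0; rewrite ?oppr_gt0 ?branch_weight_gt0 ?g'_neg ?qp
    ?phi0M1 ?branch_weightMD ?gap //.
    by have := g''_neg _ (p0 x); lra.
  by have := g''_neg _ (q0 x); lra.
Qed.
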